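(* Let $p$ be a prime. (i) Let $N\ge1$, let $K$ be an unramified extension of $\mathbb{Q}_p$ such that $\omega^{p^N}=\omega$ has exactly $p^N$ solutions in $K$, let $A$ be a commutative ultrametric $K$-Banach algebra with unit with $|A|=|K|$, and let $x\in A_0=\{a\in A:|a|\le1\}$. Then $x$ is a Teichmüller element of period $N$ (that is, $x^{p^N}=x$) if and only if there exists a spectral decomposition $$\sum_{\lambda\in T_N(K)}\pi_\lambda=1,\quad \sum_{\lambda\in T_N(K)}\lambda\pi_\lambda=x,\quad \pi_\lambda^2=\pi_\lambda,\quad \pi_\lambda\pi_{\lambda^*}=0\ (\forall\lambda\ne\lambda^* ),$$ where the $\pi_\lambda\in A$ are non-Archimedean orthogonal projections. (ii) Let $K=\widehat{\mathbb{Q}_p^{unram}}$ be the completion of the maximal unramified extension of $\mathbb{Q}_p$, let $X$ be an ultrametric Banach space over $K$ with $|X|=|K|$, and let $x$ be a bounded linear operator on $X$. Then $x$ is a Teichmüller element of period $\infty$ if and only if there exists a spectral decomposition, by bounded linear operators $\pi_\lambda$ on $X$ ($\lambda\in T(K)$), $$\sum_{\lambda\in T(K)}\pi_\lambda=1,\quad \sum_{\lambda\in T(K)}\lambda\pi_\lambda=x,\quad \pi_\lambda^2=\pi_\lambda,\quad \pi_\lambda\pi_{\lambda^*}=0\ (\forall\lambda\ne\lambda^* ),$$ where the sums converge in the strong operator topology.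
   Context: $K$ carries the unique multiplicative norm extending the $p$-adic norm, with $|p|=1/p$. Norms on $A$ and $X$ are non-Archimedean ($|a+b|\le\max(|a|,|b|)$); the norm on $A$ is submultiplicative with $|1|=1$; $|A|=|K|$ and $|X|=|K|$ mean that the sets of values of the norms coincide. Operators on $X$ are given the operator norm. $T_N(K)=\{\lambda\in K:\lambda^{p^N}=\lambda\}$ and $T(K)=\bigcup_{N\ge1}T_{N!}(K)$. $\sigma$ denotes the map $x\mapsto x^p$, so $\sigma^{M}(x)=x^{p^{M}}$. A linear operator $x$ on $X$ is a Teichmüller element of period $\infty$ if $|x|=1$ and $\sigma^{N!}(x)\to x$ as $N\to\infty$ in the strong operator topology, i.e. $\lim_{N\to\infty}\sigma^{N!}(x)(t)=x(t)$ for all $t\in X$. In (i), an orthogonal projection is an element $\pi\in A$ with $\pi^2=\pi$ and $|\pi|=1$; some of the $\pi_\lambda$ are also allowed to be $0$.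
   Formalization: In (ii), |x|=1 is assumed of the bounded operator x: as written the claim fails, since x=0 has the decomposition π_0=1 with all other π_λ=0 but is not a Teichmüller element, whose definition requires |x|=1. *)

(* Defs.v *)
From HB Require Import structures.
From mathcomp Require Import all_boot all_order all_algebra finmap.
From mathcomp Require Import all_classical all_reals all_analysis.

Set Implicit Arguments.
Unset Strict Implicit.
Unset Printing Implicit Defensive.

Import Order.TTheory GRing.Theory Num.Theory.
Import numFieldNormedType.Exports.

Local Open Scope classical_set_scope.
Local Open Scope ring_scope.

(* The normed structures of mathcomp-analysis require scalars in a
   numFieldType, which excludes p-adic fields; norms are therefore explicit
   functions with values in a realType. *)

Section Norms.
Context {R : realType}.

Definition norm_cvg (V : zmodType) (nV : V -> R) (I : Type) (F : set_system I)
    (u : I -> V) (l : V) : Prop :=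
  nV (u i - l) @[i --> F] --> (0 : R).

Definition norm_complete (V : zmodType) (nV : V -> R) : Prop :=
  forall u : nat -> V,
    (forall e : R, 0 < e -> exists N : nat,
       forall m n : nat, (N <= m)%N -> (N <= n)%N -> nV (u m - u n) < e) ->
    exists l : V, norm_cvg nV \oo u l.

Record ultra_absval (K : fieldType) (nK : K -> R) : Prop := UltraAbsval {
  absval_ge0 : forall a, 0 <= nK a;
  absval_eq0 : forall a, nK a = 0 <-> a = 0;
  absvalM : forall a b, nK (a * b) = nK a * nK b;
  absval_ultra : forall a b, nK (a + b) <= Num.max (nK a) (nK b)
}.

Record ultra_banach (K : fieldType) (nK : K -> R)
    (X : lmodType K) (nX : X -> R) : Prop := UltraBanach {
  banach_ge0 : forall t, 0 <= nX t;
  banach_eq0 : forall t, nX t = 0 <-> t = 0;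
  banachZ : forall (a : K) t, nX (a *: t) = nK a * nX t;
  banach_ultra : forall s t, nX (s + t) <= Num.max (nX s) (nX t);
  banach_complete : norm_complete nX
}.

Record ultra_banach_algebra (K : fieldType) (nK : K -> R)
    (A : comAlgType K) (nA : A -> R) : Prop := UltraBanachAlgebra {
  banach_algebra_banach : ultra_banach nK nA;
  banach_algebraM : forall a b, nA (a * b) <= nA a * nA b;
  banach_algebra1 : nA 1 = 1
}.

End Norms.

Section Fields.
Context {R : realType}.

Definition is_completion (F K : fieldType) (nF : F -> R) (nK : K -> R)
    (k : {rmorphism F -> K}) : Prop :=
  [/\ ultra_absval nK,
      norm_complete nK,
      forall a, nK (k a) = nF a
    & forall (z : K) (e : R), 0 < e -> exists a : F, nK (z - k a) < e].

Definition padic_norm (p : nat) (q : rat) : R :=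
  if q == 0 then 0
  else p%:R ^+ logn p `|denq q| / p%:R ^+ logn p `|numq q|.

(* Qp with the p-adic absolute value, up to isometric isomorphism. *)
Definition is_padic_field (p : nat) (Qp : fieldType) (nQ : Qp -> R)
    (q : {rmorphism rat -> Qp}) : Prop :=
  is_completion (padic_norm p) nQ q.

Definition algebraic_valued_ext (F K : fieldType) (nF : F -> R) (nK : K -> R)
    (i : {rmorphism F -> K}) : Prop :=
  [/\ ultra_absval nK,
      forall a, nK (i a) = nF a
    & forall z : K, algebraicOver i z].

(* Ramification index 1, of finite or infinite degree.  Separability of the
   residue extension is automatic over Qp, whose residue field is finite. *)
Definition unramified_ext (F K : fieldType) (nF : F -> R) (nK : K -> R)
    (i : {rmorphism F -> K}) : Prop :=
  algebraic_valued_ext nF nK i /\ range nK = range nF.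

(* The intermediate fields E of an algebraic extension C of F that are
   unramified over F. *)
Definition unramified_subext (F C : fieldType) (nF : F -> R) (nC : C -> R)
    (j : {rmorphism F -> C}) (E : {pred C}) : Prop :=
  [/\ divring_closed E,
      forall a, j a \in E
    & [set nC z | z in [set` E]] = range nF].

(* For C an algebraic closure of F, the maximal unramified extension of F,
   as a subset of C: the union of all the unramified extensions of F in C. *)
Definition max_unramified (F C : fieldType) (nF : F -> R) (nC : C -> R)
    (j : {rmorphism F -> C}) : set C :=
  [set z | exists2 E : {pred C}, unramified_subext nF nC j E & z \in E].

End Fields.

Definition teichmuller_set (p N : nat) (K : fieldType) : set K :=
  [set l | l ^+ (p ^ N) = l].
Arguments teichmuller_set : clear implicits.

Definition teichmuller_set_infty (p : nat) (K : fieldType) : set K :=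
  \bigcup_(N in [set N | (1 <= N)%N]) teichmuller_set p N`! K.
Arguments teichmuller_set_infty : clear implicits.

Definition teichmuller_elt (p N : nat) (A : nzRingType) (x : A) : Prop :=
  x ^+ (p ^ N) = x.

Section AlgebraDecomposition.
Context {R : realType}.

(* The values of pi outside teichmuller_set p N K play no role. *)
Definition spectral_decomposition (p N : nat) (K : fieldType)
    (A : comAlgType K) (nA : A -> R) (x : A) (pi : K -> A) : Prop :=
  let T := teichmuller_set p N K in
  [/\ \sum_(l \in T) pi l = 1,
      \sum_(l \in T) l *: pi l = x,
      forall l, T l -> pi l ^+ 2 = pi l,
      forall l m, T l -> T m -> l <> m -> pi l * pi m = 0
    & forall l, T l -> pi l = 0 \/ nA (pi l) = 1].

End AlgebraDecomposition.

Section Operators.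
Context {R : realType} (K : fieldType) (X : lmodType K) (nX : X -> R).

Definition bounded_op (f : X -> X) : Prop :=
  exists C : R, forall t, nX (f t) <= C * nX t.

(* sup is 0 on sets that are empty or unbounded: only meaningful for X nonzero
   and f bounded. *)
Definition op_norm (f : X -> X) : R :=
  sup [set nX (f t) / nX t | t in [set t | t != 0]].

Definition sigma_op (p M : nat) (f : X -> X) : X -> X := iter (p ^ M) f.

Definition teichmuller_op_infty (p : nat) (f : X -> X) : Prop :=
  op_norm f = 1 /\
  forall t, norm_cvg nX \oo (fun N => sigma_op p N`! f t) (f t).

(* Unordered convergence: along the directed set of all finite subsets. *)
Definition has_sum (I : choiceType) (D : set I) (u : I -> X) (s : X) : Prop :=
  forall e : R, 0 < e ->
    exists2 B0 : {fset I}, [set` B0] `<=` D &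
      forall B : {fset I}, (B0 `<=` B)%fset -> [set` B] `<=` D ->
        nX (\sum_(i <- B) u i - s) < e.

(* The values of pi outside teichmuller_set_infty p K play no role. *)
Definition spectral_decomposition_infty (p : nat) (x : X -> X)
    (pi : K -> {linear X -> X}) : Prop :=
  let T := teichmuller_set_infty p K in
  [/\ forall l, T l -> bounded_op (pi l),
      forall t, has_sum T (fun l => pi l t) t,
      forall t, has_sum T (fun l => l *: pi l t) (x t),
      forall l, T l -> forall t, pi l (pi l t) = pi l t
    & forall l m, T l -> T m -> l <> m -> forall t, pi l (pi m t) = 0].

End Operators.

(* Main.v *)
(* Write q = p ^ N and let L_l be the Lagrange interpolation polynomial at l of
   the roots of 'X^q - 'X.  It has coefficients in the unit ball, because the
   derivative q l ^ (q - 1) - 1 has absolute value 1.  In (i) the projections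
   are pi_l = L_l(x).  In (ii), pi_l t is the limit of L_(N!, l)(x) t: once
   |x ^ (p ^ N!) t - x t| < e, the vector t is, modulo vectors of norm < e, a sum
   of eigenvectors of x with eigenvalues in T_(N!), so that the sequence is
   constant modulo e from then on.

   For (ii) the polynomials 'X^q - 'X must split in K, that is, the fraction
   field of O = Z_p[roots of 'X^q - 'X] must be unramified over Q_p.  As the
   q-th power map is the identity on O / p O, every w in O satisfies
   w ^ q = w + p v with v in O; hence |w| = 1 or |w| = |p| |v|, and by iteration
   |w| is a power of |p|. *)

Require Import Defs.
From HB Require Import structures.
From mathcomp Require Import all_boot all_order all_algebra finmap.
From mathcomp Require Import all_classical all_reals all_analysis.
From mathcomp Require Import separable cyclotomic ring.

Set Implicit Arguments.
Unset Strict Implicit.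
Unset Printing Implicit Defensive.

Import Order.TTheory GRing.Theory Num.Theory.
Import numFieldNormedType.Exports.

Local Open Scope classical_set_scope.
Local Open Scope ring_scope.

(** * Ultrametric norms *)

Section UltrametricNorms.
Context {R : realType}.

Lemma ultra_sum_le (V : zmodType) (n : V -> R) (c : R) (I : Type) (r : seq I)
    (P : pred I) (F : I -> V) :
    n 0 <= c -> (forall a b, n (a + b) <= Num.max (n a) (n b)) ->
    (forall i, P i -> n (F i) <= c) ->
  n (\sum_(i <- r | P i) F i) <= c.
Proof.
move=> n0 nD nF; elim/big_ind: _ => // a b na nb.
by rewrite (le_trans (nD _ _))// ge_max na.
Qed.

Section Absval.
Variables (K : fieldType) (nK : K -> R).
Hypothesis nKP : ultra_absval nK.

Let ge0 := absval_ge0 nKP.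
Let nM := absvalM nKP.

Lemma absval0 : nK 0 = 0.
Proof. exact/(absval_eq0 nKP). Qed.

Lemma absval_neq0 a : a != 0 -> nK a != 0.
Proof. by apply: contra_neq => /(absval_eq0 nKP). Qed.

Lemma absval_gt0 a : a != 0 -> 0 < nK a.
Proof. by move=> a0; rewrite lt_def absval_neq0// ge0. Qed.

Lemma absval1 : nK 1 = 1.
Proof.
by apply: (mulfI (absval_neq0 (oner_neq0 K))); rewrite -nM !mulr1.
Qed.

Lemma absvalX a n : nK (a ^+ n) = nK a ^+ n.
Proof. by elim: n => [|n IH]; rewrite ?absval1// !exprS nM IH. Qed.

Lemma absvalN a : nK (- a) = nK a.
Proof.
suff n1 : nK (-1) = 1 by rewrite -mulN1r nM n1 mul1r.
apply/eqP; rewrite -(@pexpr_eq1 _ _ 2) ?ge0//.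
by rewrite -absvalX sqrrN expr1n absval1.
Qed.

Lemma absvalV a : nK a^-1 = (nK a)^-1.
Proof.
have [->|a0] := eqVneq a 0; first by rewrite invr0 absval0 invr0.
apply: (mulfI (absval_neq0 a0)); rewrite -nM mulfV// absval1 mulfV//.
exact: absval_neq0.
Qed.

Lemma absvalD_le c a b : nK a <= c -> nK b <= c -> nK (a + b) <= c.
Proof.
by move=> ha hb; rewrite (le_trans (absval_ultra nKP _ _))// ge_max ha.
Qed.

Lemma absvalB_le c a b : nK a <= c -> nK b <= c -> nK (a - b) <= c.
Proof. by move=> ha hb; rewrite absvalD_le// absvalN. Qed.

Lemma absval_nat n : nK n%:R <= 1.
Proof.
by elim: n => [|n IH]; rewrite ?absval0 ?ler01// -natr1 absvalD_le// absval1.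
Qed.

(** Were |a + b| below 1, so would be |b|, since b = (a + b) - a. *)
Lemma absval_unitD a b : nK a < 1 -> nK b = 1 -> nK (a + b) = 1.
Proof.
move=> a1 b1; apply/eqP; rewrite eq_le absvalD_le ?b1 ?(ltW a1)//=.
rewrite leNgt; apply/negP => ab1.
have : nK (a + b - a) < 1.
  by rewrite (le_lt_trans (absval_ultra nKP _ _))// gt_max absvalN ab1 a1.
by rewrite addrC addKr b1 ltxx.
Qed.

Lemma absval_root q a : (1 < q)%N -> a ^+ q = a -> nK a <= 1.
Proof.
move=> q1 aq; have [->|a0] := eqVneq a 0; first by rewrite absval0 ler01.
suff -> : nK a = 1 by [].
have /eqP : nK a ^+ q.-1 = 1.
  apply: (mulfI (absval_neq0 a0)); rewrite -exprS prednK ?(ltnW q1)//.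
  by rewrite -absvalX aq mulr1.
by rewrite pexpr_eq1 ?ge0//; [move/eqP|case: q q1 {aq} => [|[]]].
Qed.

End Absval.

Section Banach.
Variables (K : fieldType) (nK : K -> R) (X : lmodType K) (nX : X -> R).
Hypotheses (nKP : ultra_absval nK) (nXP : ultra_banach nK nX).

Lemma banach0 : nX 0 = 0.
Proof. exact/(banach_eq0 nXP). Qed.

Lemma banachN t : nX (- t) = nX t.
Proof. by rewrite -scaleN1r (banachZ nXP) absvalN// absval1// mul1r. Qed.

Lemma banachD_lt c s t : nX s < c -> nX t < c -> nX (s + t) < c.
Proof.
by move=> hs ht; rewrite (le_lt_trans (banach_ultra nXP _ _))// gt_max hs.
Qed.

Lemma banachB_lt c s t : nX s < c -> nX t < c -> nX (s - t) < c.
Proof. by move=> hs ht; rewrite banachD_lt// banachN. Qed.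

Lemma banach_sum_lt c (I : Type) (r : seq I) (P : pred I) (F : I -> X) :
  0 < c -> (forall i, P i -> nX (F i) < c) ->
  nX (\sum_(i <- r | P i) F i) < c.
Proof.
move=> c0 nF; elim/big_ind: _ => [|s t|//]; first by rewrite banach0.
exact: banachD_lt.
Qed.

Lemma banach_sum_lt_seq c (I : eqType) (r : seq I) (F : I -> X) :
  0 < c -> (forall i, i \in r -> nX (F i) < c) ->
  nX (\sum_(i <- r) F i) < c.
Proof. by move=> c0 nF; rewrite big_seq; exact: banach_sum_lt. Qed.

(** Turns estimates up to every [e] into the exact identities between limits needed later. *)
Lemma banach_small_eq0 t : (forall e, 0 < e -> nX t < e) -> t = 0.
Proof.
move=> small; apply/(banach_eq0 nXP)/eqP; rewrite eq_le (banach_ge0 nXP) andbT.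
by rewrite leNgt; apply/negP => /small; rewrite ltxx.
Qed.

Lemma norm_cvgP (u : nat -> X) (l : X) :
  norm_cvg nX \oo u l <->
  forall e, 0 < e -> exists N : nat, forall n, (N <= n)%N -> nX (u n - l) < e.
Proof.
split=> [/cvgr0Pnorm_lt cvg e /cvg [N _ uN]|cvg].
  by exists N => n /uN /=; rewrite ger0_norm// (banach_ge0 nXP).
apply/cvgr0Pnorm_lt => e /cvg [N uN]; exists N => //= n /uN.
by rewrite ger0_norm// (banach_ge0 nXP).
Qed.

End Banach.

End UltrametricNorms.
Arguments banachN {R K nK X nX}.
Arguments banach_sum_lt_seq {R K nK X nX} nXP {c I r F}.

(** * Powers of exponent p^n modulo p *)

Section Frobenius.
Variables (S : comNzRingType) (P : S -> Prop).
Hypotheses (P0 : P 0) (P1 : P 1).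
Hypothesis PD : forall a b, P a -> P b -> P (a + b).
Hypothesis PM : forall a b, P a -> P b -> P (a * b).

(** One has i C(p^n, i) = p^n C(p^n - 1, i - 1). If p did not divide C(p^n, i), then p^n would
    divide i, against 0 < i < p^n. *)
Lemma prime_dvd_bin_expn p n i : prime p -> (0 < i < p ^ n)%N ->
  (p %| 'C(p ^ n, i))%N.
Proof.
move=> p_prime /andP[i0 iq]; apply: contraLR iq => pC; rewrite -leqNgt.
apply: dvdn_leq => //.
rewrite -(@Gauss_dvdl _ _ 'C(p ^ n, i)); last first.
  by rewrite coprimeXl// prime_coprime.
by have := mul_bin_diag (p ^ n) i.-1; rewrite prednK// => <-; rewrite dvdn_mulr.
Qed.

(** The point is that the correction [v] stays in [P], which is the unit ball of Q_p in one use and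
    [teich_ring] in the other. *)
Lemma Frobenius_expn p n a b : prime p -> P a -> P b ->
  exists2 v, P v & (a + b) ^+ (p ^ n) = a ^+ (p ^ n) + b ^+ (p ^ n) + p%:R * v.
Proof.
move=> p_prime Pa Pb; have q0 : (0 < p ^ n)%N by rewrite expn_gt0 prime_gt0.
have PX c m : P c -> P (c ^+ m).
  by move=> Pc; elim: m => [|m]; rewrite ?expr0// exprS; exact: PM.
set q := (p ^ n)%N in q0 *.
(* The middle terms of the binomial expansion, with each coefficient divided by p. *)
exists (\sum_(i < q.-1) a ^+ (q - i.+1) * b ^+ i.+1 *+ ('C(q, i.+1) %/ p)).
  elim/big_ind: _ => // i _; rewrite -mulr_natr.
  apply: (PM (PM (PX _ _ Pa) (PX _ _ Pb))).
  by elim: (_ %/ _)%N => // m; rewrite -natr1 => /PD; apply.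
rewrite exprDn -[in LHS](prednK q0) big_ord_recr big_ord_recl /=.
rewrite !prednK// subnn subn0 !expr0 bin0 binn mul1r mulr1 !mulr1n -addrA.
rewrite (addrC _ (b ^+ q)) addrA; congr (_ + _).
rewrite mulr_sumr; apply: eq_bigr => i _ /=; rewrite /bump leq0n add1n.
rewrite mulrnAr mulr_natl -mulrnA mulnC divnK//.
by apply: prime_dvd_bin_expn => //=; rewrite -[ltnRHS](prednK q0) ltnS.
Qed.

End Frobenius.

(** * Roots of unity in unramified extensions *)

Lemma rat_alg_natr_neq0 (K : fieldType) (f : {rmorphism rat -> K}) n :
  (0 < n)%N -> n%:R != 0 :> K.
Proof. by move=> n0; rewrite -(rmorph_nat f) fmorph_eq0 pnatr_eq0 -lt0n. Qed.

(** * Fermat's congruence for p-adic integers *)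

Section Padic.
Context {R : realType}.
Variables (p : nat) (p_prime : prime p).

Lemma padic_norm_nat n : (0 < n)%N ->
  padic_norm p n%:R = (p%:R ^+ logn p n)^-1 :> R.
Proof.
move=> n0; rewrite /padic_norm pnatr_eq0 gtn_eqF//=.
by rewrite -[n%:R]/(n%:~R) numq_int denq_int /= logn1 expr0 mul1r.
Qed.

(** If p divides the denominator, it does not divide the numerator, and the norm is a positive power
    of p. *)
Lemma padic_norm_le1_denq r : padic_norm p r <= 1 :> R -> ~~ (p %| `|denq r|)%N.
Proof.
have p1 := prime_gt1 p_prime.
rewrite /padic_norm; have [->|r0] := eqVneq r 0.
  by rewrite (denq_int 0) /= dvdn1 gtn_eqF.
apply: contraTN => p_den; rewrite -ltNge.
have p_num : ~~ (p %| `|numq r|)%N.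
  apply/negP => p_num; have := coprime_num_den r.
  rewrite /coprime => /eqP cop; have : (p %| 1)%N by rewrite -cop dvdn_gcd p_num.
  by rewrite dvdn1 gtn_eqF.
have -> : logn p `|numq r| = 0%N.
  by apply: logn_coprime; rewrite prime_coprime.
rewrite expr0 divr1 exprn_egt1 ?ltr1n//.
rewrite -lt0n logn_gt0 mem_primes p_prime p_den andbT.
by rewrite lt0n absz_eq0 denq_neq0.
Qed.

Variables (Qp : fieldType) (nQ : Qp -> R) (q : {rmorphism rat -> Qp}).
Hypothesis Qp_padic : is_padic_field p nQ q.

Let nQP : ultra_absval nQ.
Proof. by case: Qp_padic. Qed.

Let nQq a : nQ (q a) = padic_norm p a.
Proof. by case: Qp_padic. Qed.

Lemma absval_p : nQ p%:R = p%:R^-1.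
Proof.
rewrite -(rmorph_nat q) nQq padic_norm_nat ?prime_gt0//.
by rewrite -[X in logn _ X]expn1 pfactorK// expr1.
Qed.

Lemma absval_p_lt1 : nQ p%:R < 1.
Proof. by rewrite absval_p invf_lt1 ?ltr1n ?ltr0n ?prime_gt1 ?prime_gt0. Qed.

Lemma absval_p_gt0 : 0 < nQ p%:R.
Proof. by rewrite absval_p invr_gt0 ltr0n prime_gt0. Qed.

Lemma absval_coprime n : ~~ (p %| n)%N -> nQ n%:R = 1.
Proof.
move=> pn; have n0 : (0 < n)%N by case: n pn; rewrite ?dvdn0.
rewrite -(rmorph_nat q) nQq padic_norm_nat// logn_coprime ?expr0 ?invr1//.
by rewrite prime_coprime.
Qed.

(** The set [Z] of solutions is closed under sums, negation, products and inverses of elements of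
    norm 1, so it contains all rationals with denominator prime to p. Every p-adic integer differs
    from such a rational by an element of norm below |p|, which also lies in [Z]. *)
Lemma padic_fermat n a : nQ a <= 1 -> nQ (a ^+ (p ^ n) - a) <= nQ p%:R.
Proof.
have q0 : (0 < p ^ n)%N by rewrite expn_gt0 prime_gt0.
have nM := absvalM nQP; have nB := @absvalB_le _ _ _ nQP.
have nD := @absvalD_le _ _ _ nQP; have nX := absvalX nQP.
have nN := absvalN nQP; have p0 := ltW absval_p_gt0.
pose Z a := nQ a <= 1 /\ nQ (a ^+ (p ^ n) - a) <= nQ p%:R.
have Z0 : Z 0 by rewrite /Z expr0n gtn_eqF// subrr absval0// ler01.
have Z1 : Z 1 by rewrite /Z expr1n subrr absval0// absval1.
have frob b c : nQ b <= 1 -> nQ c <= 1 -> exists2 v, nQ v <= 1 &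
    (b + c) ^+ (p ^ n) = b ^+ (p ^ n) + c ^+ (p ^ n) + p%:R * v.
  apply: (@Frobenius_expn _ (fun b => nQ b <= 1)) => //.
  - by rewrite absval0.
  - by rewrite absval1.
  - by move=> *; apply/nD.
  - by move=> ? ? ? ?; rewrite nM mulr_ile1// (absval_ge0 nQP).
have npv v : nQ v <= 1 -> nQ (p%:R * v) <= nQ p%:R.
  by move=> v1; rewrite nM ler_piMr.
have ZD b c : Z b -> Z c -> Z (b + c).
  move=> [b1 hb] [c1 hc]; split; first exact/nD.
  have [v v1 ->] := frob _ _ b1 c1.
  have -> : b ^+ (p ^ n) + c ^+ (p ^ n) + p%:R * v - (b + c) =
    (b ^+ (p ^ n) - b) + (c ^+ (p ^ n) - c) + p%:R * v by ring.
  by apply/nD; [exact/nD | exact: npv].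
(* Expanding (b + (-b))^q = 0 gives (-b)^q modulo p without distinguishing the parity of q. *)
have ZN b : Z b -> Z (- b).
  move=> [b1 hb]; have b1' : nQ (- b) <= 1 by rewrite nN.
  split => //; have [v v1] := frob _ _ b1 b1'.
  rewrite subrr expr0n gtn_eqF//= => e.
  have -> : (- b) ^+ (p ^ n) - - b = - ((b ^+ (p ^ n) - b) + p%:R * v).
    by apply/eqP; rewrite -subr_eq0; apply/eqP; rewrite [RHS]e; ring.
  by rewrite nN; apply/nD => //; exact: npv.
have ZM b c : Z b -> Z c -> Z (b * c).
  move=> [b1 hb] [c1 hc]; have nge := absval_ge0 nQP.
  split; first by rewrite nM mulr_ile1.
  have -> : (b * c) ^+ (p ^ n) - b * c =
     (b ^+ (p ^ n) - b) * c ^+ (p ^ n) + b * (c ^+ (p ^ n) - c).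
    by rewrite exprMn; ring.
  apply/nD; rewrite nM.
    by rewrite (le_trans _ hb)// ler_piMr// nX exprn_ile1.
  by rewrite (le_trans _ hc)// ler_piMl.
have ZV b : Z b -> nQ b = 1 -> Z b^-1.
  move=> [b1 hb] b1'.
  have b0 : b != 0.
    by apply: contra_eq_neq b1' => ->; rewrite absval0// eq_sym oner_eq0.
  split; first by rewrite absvalV// b1' invr1.
  have -> : b^-1 ^+ (p ^ n) - b^-1 =
      - (b ^+ (p ^ n) - b) * (b ^+ (p ^ n) * b)^-1.
    rewrite exprVn; set c := b ^+ _; have c0 : c != 0 by rewrite expf_neq0.
    by field; rewrite b0 c0.
  by rewrite nM nN absvalV// nM nX b1' expr1n mulr1 invr1 mulr1.
have Znat m : Z m%:R by elim: m => // m IH; rewrite -natr1; exact: ZD.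
have Zint (m : int) : Z m%:~R.
  by case: m => m; rewrite ?NegzE ?mulrNz; [exact: Znat|apply/ZN/Znat].
move=> a1; suff [] : Z a by [].
have [r ar] : exists r, nQ (a - q r) < nQ p%:R.
  by case: Qp_padic => _ _ _; apply; exact: absval_p_gt0.
(* Here b and its power both have norm at most |p|. *)
have ZB b : nQ b <= nQ p%:R -> Z b.
  move=> bp; have b1 := le_trans bp (ltW absval_p_lt1).
  split => //; apply/nB => //; rewrite nX -(prednK q0) exprS.
  by rewrite (le_trans _ bp)// ler_piMr ?exprn_ile1 ?(absval_ge0 nQP).
rewrite -(subrK (q r) a); apply/ZD; first exact/ZB/ltW.
have r1 : nQ (q r) <= 1.
  rewrite -[q r](subKr a) nB// (le_trans (ltW ar))//.
  exact/ltW/absval_p_lt1.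
have dr : ~~ (p %| `|denq r|)%N.
  by apply: padic_norm_le1_denq; rewrite -nQq.
have denE : (denq r)%:~R = `|denq r|%:R :> Qp by rewrite -[in LHS](absz_denq r).
rewrite -(divq_num_den r) fmorph_div !rmorph_int; apply/ZM => //.
by apply/ZV => //; rewrite denE absval_coprime.
Qed.

End Padic.

(** * The ring generated by the roots of X^(p^n) - X and its absolute values *)

Section Unramified.
Context {R : realType}.
Variables (p : nat) (p_prime : prime p).
Variables (Qp : fieldType) (nQ : Qp -> R) (q : {rmorphism rat -> Qp}).
Hypothesis Qp_padic : is_padic_field p nQ q.
Variables (C : fieldType) (nC : C -> R) (j : {rmorphism Qp -> C}).
Hypotheses (nCP : ultra_absval nC) (nCj : forall a, nC (j a) = nQ a).
Variable n : nat.
Hypothesis n_gt0 : (0 < n)%N.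

Let nQP : ultra_absval nQ.
Proof. by case: Qp_padic. Qed.

Let q_gt1 : (1 < p ^ n)%N.
Proof. by rewrite -(exp1n n) ltn_exp2r// prime_gt1. Qed.

Let nCp : nC p%:R = nQ p%:R.
Proof. by rewrite -(rmorph_nat j) nCj. Qed.

(** The ring O = Z_p[roots of X^(p^n) - X]. In this form, congruences modulo p are checked on
    generators and carried through sums and products; negation comes from -1 in Z_p. *)
Inductive teich_ring : C -> Prop :=
| TeichRingInt a : nQ a <= 1 -> teich_ring (j a)
| TeichRingRoot z : z ^+ (p ^ n) = z -> teich_ring z
| TeichRingD a b : teich_ring a -> teich_ring b -> teich_ring (a + b)
| TeichRingM a b : teich_ring a -> teich_ring b -> teich_ring (a * b).

Lemma teich_ring1 : teich_ring 1.
Proof. by apply: TeichRingRoot; rewrite expr1n. Qed.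

Lemma teich_ring0 : teich_ring 0.
Proof. by apply: TeichRingRoot; rewrite expr0n gtn_eqF// ltnW. Qed.

Lemma teich_ringN a : teich_ring a -> teich_ring (- a).
Proof.
move=> Oa; rewrite -mulN1r; apply: TeichRingM => //.
by rewrite -(rmorphN1 j); apply: TeichRingInt; rewrite absvalN// absval1.
Qed.

Lemma teich_ring_le1 w : teich_ring w -> nC w <= 1.
Proof.
elim=> [a|z zq|a b _ a1 _ b1|a b _ a1 _ b1]; first by rewrite nCj.
- exact: (absval_root nCP q_gt1).
- exact: absvalD_le.
- by rewrite (absvalM nCP) mulr_ile1// (absval_ge0 nCP).
Qed.

(** The power map is a ring endomorphism of O / p O fixing the generators: those in Z_p by
    [padic_fermat], the roots by definition. *)
Lemma teich_ring_Frobenius w : teich_ring w ->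
  exists2 v, teich_ring v & w ^+ (p ^ n) = w + p%:R * v.
Proof.
have p0 : p%:R != 0 :> Qp by rewrite (rat_alg_natr_neq0 q) ?prime_gt0.
elim=> [a a1|z zq|a b Oa [v Ov va] Ob [w' Ow wb]|a b Oa [v Ov va] Ob [w' Ow wb]].
- exists (j ((a ^+ (p ^ n) - a) / p%:R)).
    apply: TeichRingInt; rewrite (absvalM nQP) absvalV// ler_pdivrMr ?mul1r.
      exact: (padic_fermat p_prime Qp_padic).
    exact: absval_gt0.
  rewrite -(rmorph_nat j) -rmorphM -rmorphXn -rmorphD; congr (j _).
  by rewrite mulrC divfK// addrC subrK.
- by exists 0; [exact: teich_ring0|rewrite mulr0 addr0].
- have [u Ou ->] := Frobenius_expn teich_ring0 teich_ring1 TeichRingD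
    TeichRingM n p_prime Oa Ob.
  exists (v + w' + u); first by do 2!apply: TeichRingD => //.
  by rewrite va wb; ring.
- exists (v * b + a * w' + p%:R * (v * w')).
    apply: TeichRingD; first by apply: TeichRingD; exact: TeichRingM.
    apply: TeichRingM; last exact: TeichRingM.
    by rewrite -(rmorph_nat j); apply/TeichRingInt/absval_nat.
  by rewrite exprMn va wb; ring.
Qed.

(* If |w| < 1, then w (w ^ (q - 1) - 1) = p v with w ^ (q - 1) - 1 of absolute
   value 1, so that |w| = |p| |v| and the argument can be iterated on v. *)
Lemma teich_ring_absval w : teich_ring w -> w != 0 ->
  exists k, nC w = nQ p%:R ^+ k.
Proof.
have p1 := absval_p_lt1 p_prime Qp_padic; have p0 := absval_p_gt0 p_prime Qp_padic.
(* [m] bounds the number of iterations: passing from w to v divides the norm by |p|, and |p|^0 < |w|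
   is impossible in O. *)
move=> Ow w0; have [m] : exists m, nQ p%:R ^+ m < nC w.
  have /cvgr0Pnorm_lt/(_ _ (absval_gt0 nCP w0)) :
      (GRing.exp (nQ p%:R) : R^nat) @ \oo --> 0.
    by apply: cvg_expr; rewrite gtr0_norm.
  by case=> m _ /(_ m (leqnn m)) /=; rewrite gtr0_norm ?exprn_gt0//; exists m.
elim: m w Ow w0 => [|m IH] w Ow w0 ltw.
  by have := teich_ring_le1 Ow; rewrite leNgt -(expr0 (nQ p%:R)) ltw.
have := teich_ring_le1 Ow; rewrite le_eqVlt => /orP[/eqP ->|w1]; first by exists 0.
have [v Ov wv] := teich_ring_Frobenius Ow.
have q1 : (0 < (p ^ n).-1)%N by case: (p ^ n)%N q_gt1 => [|[]].
have nwv : nC w = nQ p%:R * nC v.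
  rewrite -nCp -(absvalM nCP).
  have -> : p%:R * v = w * (w ^+ (p ^ n).-1 - 1).
    rewrite mulrBr mulr1 -exprS prednK ?(ltnW q_gt1)// wv; ring.
  rewrite (absvalM nCP) absval_unitD ?mulr1//.
    by rewrite absvalX// exprn_ilt1 ?(absval_ge0 nCP)// -lt0n.
  by rewrite absvalN// absval1.
have v0 : v != 0.
  apply: contra_neq (absval_neq0 nCP w0) => v0.
  by rewrite nwv v0 absval0// mulr0.
have [|k vk] := IH v Ov v0; last by exists k.+1; rewrite nwv vk exprS.
by move: ltw; rewrite nwv exprS ltr_pM2l.
Qed.

(** The intermediate field is the fraction field of O. By [teich_ring_absval] its nonzero absolute
    values are quotients of powers of |p|, hence values already taken on Q_p. *)
Lemma teich_root_unramified z : z ^+ (p ^ n) = z -> max_unramified nQ nC j z.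
Proof.
move=> zq; pose inE z := exists a b,
  [/\ teich_ring a, teich_ring b, b != 0 & z = a / b].
have inO a : teich_ring a -> inE a.
  by move=> Oa; exists a, 1; rewrite oner_neq0 divr1; split => //; exact: teich_ring1.
exists (fun z => `[< inE z >]); last by apply/asboolP/inO; exact: TeichRingRoot.
have Ej a : `[< inE (j a) >].
  apply/asboolP; have [a1|a1] := leP (nQ a) 1; first exact/inO/TeichRingInt.
  (* When |a| > 1, the inverse of a lies in the unit ball. *)
  exists 1, (j a^-1); split; first exact: teich_ring1.
  - by apply: TeichRingInt; rewrite absvalV// invf_le1 ?ltW// (lt_trans ltr01).
  - rewrite fmorph_eq0 invr_eq0; apply: contraTneq a1 => ->.
    by rewrite absval0// -leNgt.
  - by rewrite fmorphV invrK mul1r.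
split => //.
- split=> [|x y /asboolP[a [b [Oa Ob b0 ->]]] /asboolP[c [d [Oc Od d0 ->]]]|
           x y /asboolP[a [b [Oa Ob b0 ->]]] /asboolP[c [d [Oc Od d0 ->]]]];
    apply/asboolP.
  + exact/inO/teich_ring1.
  + exists (a * d - c * b), (b * d); rewrite mulf_neq0//; split => //.
    * by apply: TeichRingD; last apply: teich_ringN; exact: TeichRingM.
    * exact: TeichRingM.
    * by field; rewrite ?b0 ?d0.
  + have [->|c0] := eqVneq c 0.
      by rewrite mul0r invr0 mulr0; apply/inO/teich_ring0.
    exists (a * d), (b * c); rewrite mulf_neq0//; split => //.
    * exact: TeichRingM.
    * exact: TeichRingM.
    * by field; rewrite ?b0 ?d0 ?c0.
- apply/seteqP; split => [_ [x /asboolP[a [b [Oa Ob b0 ->]]] <-]|_ [a _ <-]] /=.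
    have [->|a0] := eqVneq a 0.
      by exists 0 => //; rewrite mul0r !absval0.
    have [k ak] := teich_ring_absval Oa a0; have [l bl] := teich_ring_absval Ob b0.
    exists (p%:R ^+ k / p%:R ^+ l) => //.
    rewrite (absvalM nQP) (absvalM nCP) (absvalV nQP) (absvalV nCP) ak bl.
    by rewrite !(absvalX nQP).
  by exists (j a) => //; exact: Ej.
Qed.

End Unramified.

(** The list is 0 followed by the roots of X^(m-1) - 1, which is separable because m - 1 is nonzero
    in C. *)
Lemma enum_teichmuller_closed (C : closedFieldType) (m : nat) : (1 < m)%N ->
  (m.-1)%:R != 0 :> C ->
  exists s : seq C, [/\ uniq s, size s = m & forall z, z \in s -> z ^+ m = z].
Proof.
move=> m1 mC; have [s] := closed_field_poly_normal ('X^(m.-1) - 1 : {poly C}).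
have m0 : (0 < m.-1)%N by case: m m1 {mC} => [|[]].
rewrite lead_coefDl ?lead_coefXn ?scale1r; last first.
  by rewrite size_polyXn size_polyN size_poly1 ltnS.
move=> Xs; have s_root z : z \in s -> z ^+ m.-1 = 1.
  rewrite -root_prod_XsubC -Xs rootE !hornerE subr_eq0.
  by move=> /eqP.
exists (0 :: s); split.
- rewrite /= -separable_prod_XsubC -Xs separable_Xn_sub_1// andbT.
  apply/negP => /s_root; rewrite expr0n gtn_eqF// => /eqP.
  by rewrite eq_sym oner_eq0.
- have := congr1 (fun P : {poly C} => size P) Xs.
  rewrite (size_prod_XsubC s id) size_polyDl size_polyXn /=.
    by move=> -[<-]; rewrite prednK// ltnW.
  by rewrite size_polyN size_poly1 ltnS.
- move=> z; rewrite inE => /orP[/eqP ->|/s_root z1].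
    by rewrite expr0n gtn_eqF// ltnW.
  by rewrite -(prednK (ltnW m1)) exprS z1 mulr1.
Qed.

(** The roots in C are unramified, so they lie in the image of [u]; the injective maps [u] and [k]
    transport them to K. *)
Lemma enum_teichmuller (R : realType) (p : nat) (p_prime : prime p)
    (Qp : fieldType) (nQ : Qp -> R) (q : {rmorphism rat -> Qp})
    (C : closedFieldType) (nC : C -> R) (j : {rmorphism Qp -> C})
    (U : fieldType) (u : {rmorphism U -> C})
    (K : fieldType) (k : {rmorphism U -> K}) (n : nat) :
  is_padic_field p nQ q -> algebraic_valued_ext nQ nC j ->
  range u = max_unramified nQ nC j -> (0 < n)%N ->
  exists s : seq K,
    [/\ uniq s, size s = (p ^ n)%N & forall z, z \in s -> z ^+ (p ^ n) = z].
Proof.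
move=> Qp_padic [nCP nCj _] uE n0.
have q_gt1 : (1 < p ^ n)%N by rewrite -(exp1n n) ltn_exp2r// prime_gt1.
have [|s [s_uniq sz sq]] := @enum_teichmuller_closed C _ q_gt1.
  apply: (rat_alg_natr_neq0 (j \o q)); case: (p ^ n)%N q_gt1 => [|[]] //.
have /choice[f fE] : forall z, exists y, z \in s -> u y = z.
  move=> z; case: (boolP (z \in s)) => zs; last by exists 0.
  have : range u z.
    rewrite uE; apply: (teich_root_unramified p_prime Qp_padic nCP nCj n0).
    exact: sq.
  by case=> y _ <-; exists y.
have kf z : z \in s -> k (f z) ^+ (p ^ n) = k (f z).
  move=> zs; rewrite -rmorphXn; congr (k _); apply: (fmorph_inj u).
  by rewrite rmorphXn fE// sq.
exists [seq k (f z) | z <- s]; split; last 2 first.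
- by rewrite size_map.
- by move=> _ /mapP[z zs ->]; exact: kf.
rewrite map_inj_in_uniq// => y z ys zs /fmorph_inj fyz.
by rewrite -(fE _ ys) -(fE _ zs) fyz.
Qed.

(** * Interpolation at the Teichmüller representatives *)

(* For a root [l] of [Y = 'X^m - 'X], this is [Y / (('X - l) Y^`().[l])], the
   Lagrange interpolation polynomial at [l] of the set of roots of [Y]. *)
Definition teich_lagrange (K : fieldType) (m : nat) (l : K) : {poly K} :=
  (m%:R * l ^+ m.-1 - 1)^-1 *: (\poly_(i < m) l ^+ (m.-1 - i) - 1).

Section Lagrange.
Context {R : realType}.
Variables (K : fieldType) (nK : K -> R).
Hypothesis nKP : ultra_absval nK.
Variable m : nat.
Hypotheses (m_gt1 : (1 < m)%N) (nKm : nK m%:R < 1).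

Implicit Types (l mu z : K) (P : {poly K}).
Local Notation L := (@teich_lagrange K m).

(** The first term has norm below 1, as |m| < 1 and |l| <= 1. *)
Lemma teich_denom l : l ^+ m = l -> nK (m%:R * l ^+ m.-1 - 1) = 1.
Proof.
move=> /(absval_root nKP m_gt1) l1.
rewrite absval_unitD ?absvalN ?absval1// (absvalM nKP) absvalX//.
by rewrite (le_lt_trans _ nKm)// ler_piMr ?exprn_ile1 ?(absval_ge0 nKP).
Qed.

Lemma teich_denom_neq0 l : l ^+ m = l -> m%:R * l ^+ m.-1 - 1 != 0.
Proof.
move=> /teich_denom d1; apply: contra_eq_neq d1 => ->.
by rewrite absval0// eq_sym oner_eq0.
Qed.

Lemma size_teich_lagrange l : (size (L l) <= m)%N.
Proof.
rewrite (leq_trans (size_scale_leq _ _))// (leq_trans (size_polyD _ _))//.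
by rewrite geq_max size_poly size_polyN size_poly1 ltnW.
Qed.

(** Since l = l^m, the polynomial X^m - l is (X - l) times a geometric sum; subtracting X - l leaves
    X^m - X. *)
Lemma teich_lagrange_mul l : l ^+ m = l ->
  ('X - l%:P) * L l = (m%:R * l ^+ m.-1 - 1)^-1 *: ('X^m - 'X).
Proof.
move=> lm; rewrite -scalerAr; congr (_ *: _).
have e : 'X^m - l%:P = ('X - l%:P) * \poly_(i < m) l ^+ (m.-1 - i) :> {poly K}.
  rewrite -[in LHS]lm polyC_exp -opprB subrXX -mulNr opprB; congr (_ * _).
  by rewrite poly_def; apply: eq_bigr => i _; rewrite -polyC_exp mul_polyC.
by rewrite mulrBr -e mulr1; ring.
Qed.

Lemma teich_lagrange_eq1 l : l ^+ m = l -> (L l).[l] = 1.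
Proof.
move=> lm; rewrite hornerZ hornerD hornerN hornerC horner_poly.
(* At l, each of the m terms of the geometric sum equals l^(m-1). *)
rewrite (eq_bigr (fun=> l ^+ m.-1)) => [|i _]; last first.
  by rewrite -exprD subnK// -ltnS prednK// ltnW.
by rewrite sumr_const card_ord -[l ^+ _ *+ m]mulr_natl mulVf// teich_denom_neq0.
Qed.

Lemma teich_lagrange_eq0 l mu : l ^+ m = l -> mu ^+ m = mu -> mu != l ->
  (L l).[mu] = 0.
Proof.
move=> lm mum lmu.
move: (L l) (teich_lagrange_mul lm) => g /(congr1 (horner^~ mu)) /=.
rewrite !hornerE mum subrr mulr0 => /eqP.
by rewrite mulf_eq0 subr_eq0 (negbTE lmu) => /eqP.
Qed.

Lemma teich_lagrange_coef l i : l ^+ m = l -> nK (L l)`_i <= 1.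
Proof.
move=> lm; rewrite coefZ (absvalM nKP) absvalV// teich_denom// invr1 mul1r.
rewrite coefB coef_poly coef1; apply: absvalB_le => //; last exact: absval_nat.
case: ifP => _; rewrite ?absval0// absvalX// exprn_ile1 ?(absval_ge0 nKP)//.
exact: absval_root lm.
Qed.

Variable s : seq K.
Hypotheses (s_uniq : uniq s) (sz : size s = m).
Hypothesis s_root : forall z, z \in s -> z ^+ m = z.

(** Otherwise X^m - X, of degree m, would have m + 1 distinct roots. *)
Lemma teich_roots_mem z : z ^+ m = z -> z \in s.
Proof.
move=> zm; apply: contraT => zs.
suff /eqP : 'X^m - 'X = 0 :> {poly K}.
  rewrite subr_eq0 => /eqP/(congr1 (fun P : {poly K} => size P)).
  by rewrite size_polyXn size_polyX => -[m1]; by move: m_gt1; rewrite m1.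
apply: (@roots_geq_poly_eq0 _ _ (z :: s)).
- rewrite /= rootE !hornerE zm subrr eqxx/=; apply/allP => y ys.
  by rewrite rootE !hornerE s_root// subrr.
- by rewrite /= zs.
- rewrite /= sz (leq_trans (size_polyD _ _))// geq_max size_polyXn leqnn.
  by rewrite size_polyN size_polyX ltnW.
Qed.

(** The difference of the two sides has degree below m and vanishes at the m elements of [s]. *)
Lemma teich_lagrange_interp P : (size P <= m)%N ->
  \sum_(l <- s) P.[l] *: L l = P.
Proof.
move=> szP; apply/eqP; rewrite -subr_eq0; apply/eqP.
apply: (@roots_geq_poly_eq0 _ _ s) => //; last first.
  rewrite sz (leq_trans (size_polyD _ _))// geq_max size_polyN szP andbT.
  elim/big_ind: _ => [|a b ha hb|l _]; first by rewrite size_poly0.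
    by rewrite (leq_trans (size_polyD _ _))// geq_max ha.
  by rewrite (leq_trans (size_scale_leq _ _)) ?size_teich_lagrange.
apply/allP => z zs; rewrite rootE hornerD hornerN horner_sum.
rewrite (bigD1_seq z)//= hornerZ teich_lagrange_eq1 ?s_root// mulr1.
rewrite big_seq_cond big1 ?addr0 ?subrr// => l /andP[ls lz].
by rewrite hornerZ teich_lagrange_eq0 ?s_root ?mulr0// eq_sym.
Qed.

Lemma sum_teich_lagrange : \sum_(l <- s) L l = 1.
Proof.
rewrite -[RHS]teich_lagrange_interp ?size_poly1 ?(ltnW m_gt1)//.
by apply: eq_bigr => l _; rewrite hornerC scale1r.
Qed.

Lemma sumZ_teich_lagrange : \sum_(l <- s) l *: L l = 'X.
Proof.
rewrite -[RHS]teich_lagrange_interp ?size_polyX//.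
by apply: eq_bigr => l _; rewrite hornerX.
Qed.

End Lagrange.

(** * Polynomials in a linear operator *)

Section PolyOp.
Variables (K : fieldType) (X : lmodType K) (x : {linear X -> X}).

Implicit Types (l a : K) (f g : {poly K}) (s t : X).

(** The vector f(x) t. Using only iterates of [x] on vectors, it serves both for multiplication by
    an element of A and for operators on X. *)
Definition poly_op (f : {poly K}) (t : X) : X :=
  \sum_(i < size f) f`_i *: iter i x t.

Lemma poly_op_wide n f t : (size f <= n)%N ->
  poly_op f t = \sum_(i < n) f`_i *: iter i x t.
Proof.
move=> fn; rewrite /poly_op (big_ord_widen n (fun i => f`_i *: iter i x t))//.
rewrite big_mkcond; apply: eq_bigr => i _; case: ltnP => // fi.
by rewrite nth_default// scale0r.
Qed.

Lemma poly_opP a f g t :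
  poly_op (a *: f + g) t = a *: poly_op f t + poly_op g t.
Proof.
pose n := maxn (size f) (size g).
rewrite (@poly_op_wide n f) ?leq_maxl// (@poly_op_wide n g) ?leq_maxr//.
rewrite (@poly_op_wide n); last first.
  rewrite (leq_trans (size_polyD _ _))// geq_max leq_maxr andbT.
  by rewrite (leq_trans (size_scale_leq _ _)) ?leq_maxl.
rewrite scaler_sumr -big_split; apply: eq_bigr => i _ /=.
by rewrite coefD coefZ scalerDl scalerA.
Qed.

Lemma poly_op0 t : poly_op 0 t = 0.
Proof. by rewrite /poly_op size_poly0 big_ord0. Qed.

Lemma poly_opD f g t : poly_op (f + g) t = poly_op f t + poly_op g t.
Proof. by have := poly_opP 1 f g t; rewrite !scale1r. Qed.

Lemma poly_opZ a f t : poly_op (a *: f) t = a *: poly_op f t.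
Proof. by have := poly_opP a f 0 t; rewrite poly_op0 !addr0. Qed.

Lemma poly_opB f g t : poly_op (f - g) t = poly_op f t - poly_op g t.
Proof. by rewrite poly_opD -[- g]scaleN1r poly_opZ scaleN1r. Qed.

Lemma poly_op_sum (I : Type) (r : seq I) (F : I -> {poly K}) t :
  poly_op (\sum_(i <- r) F i) t = \sum_(i <- r) poly_op (F i) t.
Proof.
by elim: r => [|i r IH]; rewrite ?big_nil ?poly_op0// !big_cons poly_opD IH.
Qed.

Lemma poly_opXn n t : poly_op 'X^n t = iter n x t.
Proof.
rewrite /poly_op size_polyXn big_ord_recr /= coefXn eqxx scale1r big1 ?add0r//.
by move=> i _; rewrite coefXn ltn_eqF// scale0r.
Qed.

Lemma poly_op1 t : poly_op 1 t = t.
Proof. by rewrite -(expr0 'X) poly_opXn. Qed.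

Lemma poly_opX t : poly_op 'X t = x t.
Proof. exact: (poly_opXn 1). Qed.

Lemma poly_opMX f t : poly_op ('X * f) t = x (poly_op f t).
Proof.
rewrite (@poly_op_wide (size f).+1); last first.
  by rewrite (leq_trans (size_polyMleq _ _))// size_polyX.
rewrite big_ord_recl coefXM scale0r add0r linear_sum.
by apply: eq_bigr => i _; rewrite coefXM linearZ.
Qed.

Lemma poly_op_linear f : linear (poly_op f).
Proof.
move=> a s t; rewrite /poly_op scaler_sumr -big_split; apply: eq_bigr => i _ /=.
suff -> : iter i x (a *: s + t) = a *: iter i x s + iter i x t.
  by rewrite scalerDr !scalerA mulrC.
by elim: (i : nat) => //= n ->; rewrite linearP.
Qed.

Lemma iter_eigen l t n : x t = l *: t -> iter n x t = l ^+ n *: t.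
Proof.
move=> xt; elim: n => [|n /= ->]; first by rewrite expr0 scale1r.
by rewrite linearZ xt /= scalerA -exprSr.
Qed.

Lemma poly_op_eigen l f t : x t = l *: t -> poly_op f t = f.[l] *: t.
Proof.
move=> xt; rewrite horner_coef scaler_suml; apply: eq_bigr => i _.
by rewrite (iter_eigen _ xt) scalerA.
Qed.

Section Norm.
Context {R : realType}.
Variables (nK : K -> R) (nX : X -> R).
Hypotheses (nKP : ultra_absval nK) (nXP : ultra_banach nK nX).
Hypothesis x_le1 : forall t, nX (x t) <= nX t.

Lemma poly_op_le f t : (forall i, nK f`_i <= 1) -> nX (poly_op f t) <= nX t.
Proof.
move=> f1; apply: ultra_sum_le => [||i _].
- by rewrite (banach0 nXP) (banach_ge0 nXP).
- exact: banach_ultra nXP.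
- rewrite (banachZ nXP) (@le_trans _ _ (nX (iter i x t)))//.
    by rewrite ler_piMl// (banach_ge0 nXP).
  by elim: (i : nat) => //= n; exact: le_trans.
Qed.

(** Neither [x] nor multiplication by l increases norms, so x^i t - l^i t stays below [e], by
    induction from x^(n+1) t - l^(n+1) t = x (x^n t - l^n t) + l^n (x t - l t). *)
Lemma poly_op_approx_eigen e l f t : 0 < e -> nK l <= 1 ->
  (forall i, nK f`_i <= 1) -> nX (x t - l *: t) < e ->
  nX (poly_op f t - f.[l] *: t) < e.
Proof.
move=> e0 l1 f1 xt; rewrite horner_coef scaler_suml -sumrB.
apply: (banach_sum_lt nXP) => // i _.
rewrite -scalerA -scalerBr (banachZ nXP).
apply: (@le_lt_trans _ _ (nX (iter i x t - l ^+ i *: t))).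
  by rewrite ler_piMl// (banach_ge0 nXP).
elim: (i : nat) => [|n IH]; first by rewrite expr0 scale1r subrr (banach0 nXP).
have -> : iter n.+1 x t - l ^+ n.+1 *: t =
    x (iter n x t - l ^+ n *: t) + l ^+ n *: (x t - l *: t).
  have xZ : x (l ^+ n *: t) = l ^+ n *: x t by rewrite linearZ.
  by rewrite (linearB x) xZ scalerBr scalerA -exprSr addrA subrK.
apply: (banachD_lt nXP); first exact: le_lt_trans IH.
rewrite (banachZ nXP) (le_lt_trans _ xt)// ler_piMl ?(banach_ge0 nXP)//.
by rewrite absvalX// exprn_ile1 ?(absval_ge0 nKP).
Qed.

Variables (m : nat).
Hypotheses (m_gt1 : (1 < m)%N) (nKm : nK m%:R < 1).

(** By [teich_lagrange_mul], (x - l) L_l(x) t is x^m t - x t times a scalar of absolute value 1. *)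
Lemma teich_lagrange_approx_eigen e l t : l ^+ m = l ->
  nX (iter m x t - x t) < e ->
  nX (x (poly_op (teich_lagrange m l) t) - l *: poly_op (teich_lagrange m l) t)
    < e.
Proof.
move=> lm xt; set s := poly_op _ t; suff -> : x s - l *: s =
     (m%:R * l ^+ m.-1 - 1)^-1 *: (iter m x t - x t).
  by rewrite (banachZ nXP) absvalV// (teich_denom nKP)// invr1 mul1r.
rewrite /s {s}; move: (teich_lagrange m l) (teich_lagrange_mul lm) => g ge.
rewrite -poly_opMX -poly_opZ -poly_opB -mul_polyC -mulrBl ge.
by rewrite poly_opZ poly_opB poly_opXn poly_opX.
Qed.

Lemma teich_lagrange_eigen l t : l ^+ m = l -> iter m x t = x t ->
  x (poly_op (teich_lagrange m l) t) = l *: poly_op (teich_lagrange m l) t.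
Proof.
move=> lm xt; apply/eqP; rewrite -subr_eq0; apply/eqP.
apply: (banach_small_eq0 nXP) => e e0; apply: teich_lagrange_approx_eigen => //.
by rewrite xt subrr (banach0 nXP).
Qed.

End Norm.
End PolyOp.

(** * Spectral decompositions *)

Section AlgebraCase.
Context {R : realType}.
Variables (K : fieldType) (nK : K -> R) (A : comAlgType K) (nA : A -> R).
Hypotheses (nKP : ultra_absval nK) (nAP : ultra_banach_algebra nK nA).
Variables (p N : nat) (x : A) (s : seq K).
Local Notation m := (p ^ N)%N.
Hypotheses (m_gt1 : (1 < m)%N) (nKm : nK m%:R < 1).
Hypotheses (s_uniq : uniq s) (sz : size s = m).
Hypothesis s_root : forall z, z \in s -> z ^+ m = z.

Local Notation mulx := (x \*o idfun : {linear A -> A}).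

Let nAX : ultra_banach nK nA := banach_algebra_banach nAP.

Let TE : teichmuller_set p N K = [set` s].
Proof.
apply/seteqP; split => z /= => [|/s_root//].
exact: teich_roots_mem.
Qed.

Let iter_mulx n t : iter n mulx t = x ^+ n * t.
Proof. by elim: n => [|n /= ->]; rewrite ?mul1r// mulrA -exprS. Qed.

(** Lets a product of two projections be read as a polynomial in [x] acting on an eigenvector. *)
Let poly_op_mulx f t : poly_op mulx f t = poly_op mulx f 1 * t.
Proof.
rewrite /poly_op mulr_suml; apply: eq_bigr => i _.
by rewrite !iter_mulx mulr1 -scalerAl.
Qed.

Lemma teichmuller_elt_decomposition : nA x <= 1 -> teichmuller_elt p N x ->
  exists pi : K -> A, spectral_decomposition p N nA x pi.
Proof.
move=> x1 xm; pose pi l := poly_op mulx (teich_lagrange m l) 1.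
have mulx_le t : nA (mulx t) <= nA t.
  rewrite (le_trans (banach_algebraM nAP _ _))// ler_piMl//.
  exact: banach_ge0 nAX _.
have pi_eigen l : l ^+ m = l -> mulx (pi l) = l *: pi l.
  move=> lm; apply: (teich_lagrange_eigen nKP nAX) => //.
  by rewrite iter_mulx xm.
(* Idempotence and orthogonality both follow, as L_mu takes the value 1 at mu and 0 at the other
   roots. *)
have pi_mul l mu : l ^+ m = l ->
    pi mu * pi l = (teich_lagrange m mu).[l] *: pi l.
  by move=> lm; rewrite -poly_op_mulx; apply: poly_op_eigen; exact: pi_eigen.
have pi2 l : l ^+ m = l -> pi l ^+ 2 = pi l.
  by move=> lm; rewrite expr2 pi_mul// (teich_lagrange_eq1 nKP)// scale1r.
exists pi; split.
- rewrite TE -fsbig_seq//= -poly_op_sum (sum_teich_lagrange nKP)//.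
  exact: poly_op1.
- rewrite TE -fsbig_seq//= (eq_bigr (fun l =>
    poly_op mulx (l *: teich_lagrange m l) 1)) => [|l _]; last by rewrite poly_opZ.
  by rewrite -poly_op_sum (sumZ_teich_lagrange nKP)// poly_opX /= mulr1.
- by move=> l; exact: pi2.
- move=> l mu lm mum lmu; rewrite pi_mul// teich_lagrange_eq0 ?scale0r//.
  by apply/eqP => mul; exact: lmu.
- move=> l lm; have [->|pi0] := eqVneq (pi l) 0; [by left|right].
  (* The upper bound holds because L_l has coefficients in the unit ball; the lower one because |pi|
     = |pi^2| <= |pi|^2 and |pi| > 0. *)
  apply/eqP; rewrite eq_le; apply/andP; split.
    rewrite -(banach_algebra1 nAP); apply: (poly_op_le nAX) => // i.
    exact: teich_lagrange_coef.
  have npi0 : 0 < nA (pi l).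
    rewrite lt_def (banach_ge0 nAX) andbT.
    by apply: contra_neq pi0 => /(banach_eq0 nAX).
  rewrite -(ler_pM2l npi0) mulr1 -{1}(pi2 _ lm).
  exact: banach_algebraM nAP _ _.
Qed.

(** Orthogonality gives x pi_l = l pi_l, so x^(p^N) is the sum of the l^(p^N) pi_l = l pi_l. *)
Lemma decomposition_teichmuller_elt (pi : K -> A) :
  spectral_decomposition p N nA x pi -> teichmuller_elt p N x.
Proof.
rewrite /spectral_decomposition TE -!fsbig_seq//= => -[pi1 pix pi2 pi_orth _].
have pi_eigen l : l \in s -> mulx (pi l) = l *: pi l.
  move=> ls; rewrite /= -{1}pix mulr_suml (bigD1_seq l)//= -scalerAl -expr2 pi2//.
  rewrite big_seq_cond big1 ?addr0// => mu /andP[mus mul].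
  by rewrite -scalerAl pi_orth ?scaler0//; exact/eqP.
rewrite /teichmuller_elt -[LHS]mulr1 -pi1 mulr_sumr -[RHS]pix.
apply: eq_big_seq => l ls.
by rewrite -iter_mulx (iter_eigen _ (pi_eigen _ ls)) s_root.
Qed.

End AlgebraCase.

Definition linear_of (K : fieldType) (X : lmodType K) (g : X -> X)
    (g_lin : linear g) : {linear X -> X} :=
  HB.pack g (GRing.isLinear.Build K X X *:%R g g_lin).

(** * Infinite period, for operators on a Banach space *)

Section OperatorCase.
Context {R : realType}.
Variables (K : fieldType) (nK : K -> R) (X : lmodType K) (nX : X -> R).
Hypotheses (nKP : ultra_absval nK) (nXP : ultra_banach nK nX).

Lemma norm_cvg_linear (u v : nat -> X) (a : K) (y z : X) :
  norm_cvg nX \oo u y -> norm_cvg nX \oo v z ->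
  norm_cvg nX \oo (fun n => a *: u n + v n) (a *: y + z).
Proof.
move=> /(norm_cvgP nXP) uy /(norm_cvgP nXP) vz; apply/(norm_cvgP nXP) => e e0.
(* Dividing by |a| + 1 instead of |a| covers a = 0. *)
have a0 : 0 < nK a + 1 by rewrite ltr_wpDl// (absval_ge0 nKP).
have [N1 uN] := uy _ (divr_gt0 e0 a0); have [N2 vN] := vz _ e0.
exists (maxn N1 N2) => n; rewrite geq_max => /andP[/uN un /vN vn].
rewrite opprD addrACA -scalerBr; apply: (banachD_lt nXP) => //.
rewrite (banachZ nXP) mulrC; move: un; rewrite ltr_pdivlMr//.
by apply: le_lt_trans; rewrite ler_wpM2l ?(banach_ge0 nXP)// lerDl.
Qed.

Lemma norm_cvg_unique (u : nat -> X) (y z : X) :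
  norm_cvg nX \oo u y -> norm_cvg nX \oo u z -> y = z.
Proof.
move=> /(norm_cvgP nXP) uy /(norm_cvgP nXP) uz; apply/eqP; rewrite -subr_eq0.
apply/eqP/(banach_small_eq0 nXP) => e e0.
have [N1 uN1] := uy _ e0; have [N2 uN2] := uz _ e0.
have -> : y - z = (u (maxn N1 N2) - z) - (u (maxn N1 N2) - y).
  by rewrite opprB [RHS]addrC addrA subrK.
apply: (banachB_lt nKP nXP).
  by apply: uN2; rewrite leq_maxr.
by apply: uN1; rewrite leq_maxl.
Qed.

Lemma op_norm_ub (f : {linear X -> X}) t : bounded_op nX f ->
  nX (f t) <= op_norm nX f * nX t.
Proof.
move=> [c fc]; have [->|t0] := eqVneq t 0.
  by rewrite linear0 (banach0 nXP) mulr0.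
have nX_gt0 (y : X) : y != 0 -> 0 < nX y.
  move=> y0; rewrite lt_def (banach_ge0 nXP) andbT.
  by apply: contra_neq y0 => /(banach_eq0 nXP).
rewrite -ler_pdivrMr ?nX_gt0//; apply: ub_le_sup; last by exists t.
by exists c => _ [y y0 <-]; rewrite ler_pdivrMr ?nX_gt0.
Qed.

Variables (p : nat) (p_prime : prime p).
Hypothesis nKp : nK p%:R < 1.
Variable x : {linear X -> X}.
Hypothesis x_le1 : forall t, nX (x t) <= nX t.

Local Notation m N := (p ^ N`!)%N.
Local Notation T := (teichmuller_set_infty p K).

(** As N! divides M!, the larger power map is an iterate of the smaller one, which fixes l. *)
Lemma teich_root_mono N M (l : K) : (N <= M)%N -> l ^+ m N = l -> l ^+ m M = l.
Proof.
move=> NM lN; have /dvdnP[c ->] : (N`! %| M`!)%N.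
  rewrite -(subnK NM); elim: (M - N)%N => // k IH.
  by rewrite addSn factS dvdn_mull.
elim: c => [|c IH]; first by rewrite mul0n expn0 expr1.
by rewrite mulSn expnD exprM lN.
Qed.

Lemma teich_infty_near (l : K) : T l ->
  exists N0, forall N, (N0 <= N)%N -> l ^+ m N = l.
Proof. by move=> [N _ lN]; exists N => M NM; exact: teich_root_mono lN. Qed.

Lemma iter_norm_le n t : nX (iter n x t) <= nX t.
Proof. by elim: n => //= n; exact: le_trans. Qed.

Section Backward.
Variable pi : K -> {linear X -> X}.

(** Up to an error below [e], t is a finite sum of eigenvectors. For N large, x^(p^N!) and x agree
    on that sum, and neither increases the norm of the error. *)
Lemma decomposition_teichmuller_op :
  spectral_decomposition_infty nX p x pi ->
  forall t, norm_cvg nX \oo (fun N => sigma_op p N`! x t) (x t).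
Proof.
move=> [_ pi1 pix pi2 pi_orth] t.
(* Over any finite set containing mu, the sum for x (pi mu t) collapses to its term at mu. *)
have pi_eigen mu : T mu -> x (pi mu t) = mu *: pi mu t.
  move=> Tmu; apply/eqP; rewrite eq_sym -subr_eq0.
  apply/eqP/(banach_small_eq0 nXP) => e e0.
  have [B0 B0T] := pix (pi mu t) e e0.
  move=> /(_ (B0 `|` [fset mu])%fset (fsubsetUl _ _)).
  rewrite (big_fsetD1 mu) ?inE ?eqxx ?orbT//= pi2// big_seq_cond big1 ?addr0.
    by apply => l; rewrite /= !inE => /orP[/B0T//|/eqP ->].
  move=> l /andP[]; rewrite !inE => /andP[lmu lB] _.
  rewrite pi_orth ?scaler0//; last exact/eqP.
  by case/orP: lB => [/B0T//|/eqP lE]; rewrite lE eqxx in lmu.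
apply/(norm_cvgP nXP) => e e0.
have [B0 B0T /(_ B0 (fsubset_refl _) B0T) tB0] := pi1 t e e0.
(* [B0] is finite, so one level works for all its elements. *)
have [N0 B0N] : exists N0, forall N, (N0 <= N)%N ->
    forall l, l \in enum_fset B0 -> l ^+ m N = l.
  have {}B0T l : l \in enum_fset B0 -> T l by move=> lB; exact: B0T.
  elim: (enum_fset B0) B0T => [|l r IH] rT; first by exists 0%N.
  have [|N1 lN1] := @teich_infty_near l; first by apply: rT; rewrite mem_head.
  have [|N2 rN2] := IH; first by move=> k kr; apply: rT; rewrite inE kr orbT.
  exists (maxn N1 N2) => N; rewrite geq_max => /andP[N1N N2N] k.
  by rewrite inE => /orP[/eqP ->|]; [exact: lN1|exact: rN2].
exists N0 => N N0N; rewrite /sigma_op.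
set r := \sum_(l <- B0) pi l t - t in tB0.
have iterB n y z : iter n x (y - z) = iter n x y - iter n x z.
  by elim: n => //= n ->; rewrite linearB.
have iterS : iter (m N) x (t + r) = x (t + r).
  rewrite /r addrC subrK.
  have iter_sum n (I : Type) (rr : seq I) (F : I -> X) :
      iter n x (\sum_(i <- rr) F i) = \sum_(i <- rr) iter n x (F i).
    elim: n => //= n ->; exact: linear_sum.
  rewrite iter_sum linear_sum; apply: eq_big_seq => l lB.
  have xl := pi_eigen l (B0T l lB).
  by rewrite (iter_eigen _ xl) xl B0N.
have -> : iter (m N) x t - x t = x r - iter (m N) x r.
  have -> : t = (t + r) - r by rewrite addrK.
  by rewrite iterB iterS (linearB x) opprB [LHS]addrC subrKA.
apply: (banachB_lt nKP nXP); first exact: le_lt_trans tB0.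
by rewrite (le_lt_trans (iter_norm_le _ _)).
Qed.

End Backward.

Section Forward.
Hypothesis roots : forall N, exists s : seq K,
  [/\ uniq s, size s = m N & forall z, z \in s -> z ^+ m N = z].

Let m_gt1 N : (1 < m N)%N.
Proof. by rewrite -(exp1n N`!) ltn_exp2r ?fact_gt0// prime_gt1. Qed.

Let nKm N : nK (m N)%:R < 1.
Proof.
rewrite natrX absvalX// exprn_ilt1 ?(absval_ge0 nKP)// -lt0n.
exact: fact_gt0.
Qed.

Let L N l t := poly_op x (teich_lagrange (m N) l) t.

Let L_le N l t : l ^+ m N = l -> nX (L N l t) <= nX t.
Proof.
move=> lN; apply: (poly_op_le nXP) => // i.
exact: (teich_lagrange_coef nKP (m_gt1 N) (nKm N)).
Qed.

Let L_linear N l : linear (L N l).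
Proof. exact: poly_op_linear. Qed.

(* Modulo vectors of norm < e, x satisfies x ^ (p ^ N!) = x on the cyclic space
   of t, so that L N l t is the component of t of eigenvalue l; interpolating
   at the larger set of roots of level M does not change it. *)
Lemma teich_lagrange_stable e t N M l : 0 < e -> (N <= M)%N ->
  nX (iter (m N) x t - x t) < e -> l ^+ m M = l ->
  nX (L M l t - (if l ^+ m N == l then L N l t else 0)) < e.
Proof.
move=> e0 NM xt lM; have [s [s_uniq sz s_root]] := roots N.
have sP z : (z \in s) = (z ^+ m N == z).
  apply/idP/eqP => [/s_root//|].
  exact: (teich_roots_mem (m_gt1 N) s_uniq sz s_root).
have tE : t = \sum_(mu <- s) L N mu t.
  rewrite -poly_op_sum (sum_teich_lagrange nKP (m_gt1 N) (nKm N) s_uniq sz)//.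
  by rewrite poly_op1.
have -> : (if l ^+ m N == l then L N l t else 0) =
    \sum_(mu <- s) (teich_lagrange (m M) l).[mu] *: L N mu t.
  (* Roots of level N are also roots of level M, so the interpolation polynomial of level M vanishes
     at them, except at l. *)
  have tl_neq mu : mu \in s -> mu != l -> (teich_lagrange (m M) l).[mu] = 0.
    move=> /s_root muN mul; apply: teich_lagrange_eq0 => //.
    exact: teich_root_mono muN.
  rewrite -sP; case: ifPn => ls.
    rewrite (bigD1_seq l)//= (teich_lagrange_eq1 nKP)// scale1r.
    by rewrite big_seq_cond big1 ?addr0// => mu /andP[? ?]; rewrite tl_neq ?scale0r.
  rewrite big_seq big1// => mu mus; rewrite tl_neq ?scale0r//.
  by apply: contraNneq ls => <-.
have -> : L M l t = \sum_(mu <- s) L M l (L N mu t).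
  by rewrite {1}tE; exact: (linear_sum (linear_of (L_linear M l))).
rewrite -sumrB.
apply: (banach_sum_lt_seq nXP) => // mu /s_root muN.
apply: (poly_op_approx_eigen nKP nXP) => //.
- exact: (absval_root nKP (m_gt1 N)).
- by move=> i; exact: (teich_lagrange_coef nKP (m_gt1 M) (nKm M)).
- exact: (teich_lagrange_approx_eigen nKP nXP).
Qed.

Hypothesis x_teich :
  forall t, norm_cvg nX \oo (fun N => sigma_op p N`! x t) (x t).

Let x_near t e : 0 < e -> exists N0, forall N, (N0 <= N)%N ->
  nX (iter (m N) x t - x t) < e.
Proof. by move/(norm_cvgP nXP): (x_teich t); apply. Qed.

(** The sequence is Cauchy: by [teich_lagrange_stable], all terms from level N on are within [e] of
    the term at N. *)
Lemma teich_lagrange_cvg l t : T l ->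
  exists y, norm_cvg nX \oo (fun N => L N l t) y.
Proof.
move=> /teich_infty_near[N1 lN1]; apply: (banach_complete nXP) => e e0.
have [N2 xN2] := x_near t e0; pose N := maxn N1 N2.
have lN : l ^+ m N = l by apply: lN1; rewrite leq_maxl.
have LN M : (N <= M)%N -> nX (L M l t - L N l t) < e.
  move=> NM; have := teich_lagrange_stable e0 NM.
  move=> /(_ t l); rewrite lN eqxx; apply; first by apply: xN2; rewrite leq_maxr.
  exact: teich_root_mono lN.
exists N => M M' NM NM'.
have -> : L M l t - L M' l t = (L M l t - L N l t) - (L M' l t - L N l t).
  by rewrite opprB addrA subrK.
by apply: (banachB_lt nKP nXP); exact: LN.
Qed.

Lemma teich_projection l : exists f : {linear X -> X},
  T l -> forall t, norm_cvg nX \oo (fun N => L N l t) (f t).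
Proof.
(* Outside [T] the zero operator is the default value. *)
have [Tl|nTl] := pselect (T l); last by exists (linear_of (poly_op_linear x 0)) => /nTl.
have /choice[g gP] t := @teich_lagrange_cvg l t Tl.
have g_lin : linear g.
  move=> a s t; apply: norm_cvg_unique (gP _) _.
  have -> : (fun N => L N l (a *: s + t)) = fun N => a *: L N l s + L N l t.
    by apply/funext => N; exact: L_linear.
  exact: norm_cvg_linear.
by exists (linear_of g_lin).
Qed.

Lemma teichmuller_op_decomposition :
  exists pi : K -> {linear X -> X}, spectral_decomposition_infty nX p x pi.
Proof.
have /choice[pi piP] := teich_projection.
have piN l t e : T l -> 0 < e ->
    exists N0, forall N, (N0 <= N)%N -> l ^+ m N = l /\ nX (L N l t - pi l t) < e.
  move=> Tl e0; have [N1 lN1] := teich_infty_near Tl.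
  have /(norm_cvgP nXP)/(_ _ e0)[N2 LN2] := piP l Tl t.
  exists (maxn N1 N2) => N; rewrite geq_max => /andP[? ?].
  by split; [exact: lN1|exact: LN2].
(* [teich_lagrange_stable] passes to the limit in M with the same strict bound, by the ultrametric
   inequality. *)
have pi_stable e t N l : 0 < e -> nX (iter (m N) x t - x t) < e -> T l ->
    nX (pi l t - (if l ^+ m N == l then L N l t else 0)) < e.
  move=> e0 xt Tl; have [M0 piM0] := piN l t e Tl e0.
  have [lM LM] := piM0 (maxn M0 N) (leq_maxl _ _).
  have := teich_lagrange_stable e0 (leq_maxr M0 N) xt lM.
  move: (if _ then _ else _) LM => y; move: (L _ l t) => z zpi zy.
  have -> : pi l t - y = (z - y) - (z - pi l t).
    by rewrite opprB [RHS]addrC addrA subrK.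
  exact: (banachB_lt nKP nXP).
have pi_le l t : T l -> nX (pi l t) <= nX t.
  move=> Tl; rewrite leNgt; apply/negP => lt_t.
  (* Approximating within the norm of [pi l t] itself would make that norm smaller than itself. *)
  have e0 : 0 < nX (pi l t) by rewrite (le_lt_trans _ lt_t)// (banach_ge0 nXP).
  have [N0 /(_ N0 (leqnn _))[lN LN]] := piN l t _ Tl e0.
  suff : nX (pi l t) < nX (pi l t) by rewrite ltxx.
  rewrite -{1}(subKr (L N0 l t) (pi l t)); apply: (banachB_lt nKP nXP) => //.
  by rewrite (le_lt_trans _ lt_t)// L_le.
have pi_eigen l t : T l -> x (pi l t) = l *: pi l t.
  move=> Tl; apply/eqP; rewrite -subr_eq0.
  apply/eqP/(banach_small_eq0 nXP) => e e0.
  have [N1 piN1] := piN l t e Tl e0; have [N2 xN2] := x_near t e0.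
  have [lN LN] := piN1 _ (leq_maxl N1 N2).
  have {}xN2 := xN2 _ (leq_maxr N1 N2); move: (maxn N1 N2) => N in lN LN xN2 *.
  have LE := teich_lagrange_approx_eigen nKP nXP (m_gt1 N) (nKm N) lN xN2.
  have -> : x (pi l t) - l *: pi l t =
      (x (L N l t) - l *: L N l t) - (x (L N l t - pi l t) - l *: (L N l t - pi l t)).
    by rewrite (linearB x) scalerBr !opprB addrA subrKA [RHS]addrC subrKA.
  apply: (banachB_lt nKP nXP) => //; apply: (banachB_lt nKP nXP).
    exact: le_lt_trans LN.
  rewrite (banachZ nXP) (le_lt_trans _ LN)// ler_piMl ?(banach_ge0 nXP)//.
  exact: absval_root lN.
(* On the eigenvector [pi mu t], L_l(x) acts as the scalar L_l(mu), which is 1 or 0 at every large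
   level. *)
have pi_pi l mu t : T l -> T mu ->
    pi l (pi mu t) = (if l == mu then pi mu t else 0).
  move=> Tl Tmu; apply/eqP; rewrite eq_sym -subr_eq0.
  apply/eqP/(banach_small_eq0 nXP) => e e0.
  have [N1 piN1] := piN l (pi mu t) e Tl e0.
  have [N2 muN2] := teich_infty_near Tmu.
  have [lN LN] := piN1 _ (leq_maxl N1 N2); have muN := muN2 _ (leq_maxr N1 N2).
  move: (maxn _ _) lN muN LN => N lN muN.
  rewrite /L (poly_op_eigen _ (pi_eigen mu t Tmu)).
  have [->|lmu] := eqVneq l mu.
    by rewrite (teich_lagrange_eq1 nKP)// scale1r.
  by rewrite teich_lagrange_eq0 ?scale0r// eq_sym.
(* One estimate for both sums: c = 1 yields the decomposition of t, c = id that of x t. Each is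
   compared with the interpolation sum at a finite level. *)
have pi_sum (c : K -> K) e t : (forall l, T l -> nK (c l) <= 1) -> 0 < e ->
    exists N, exists2 B0 : {fset K}, [set` B0] `<=` T &
      forall B : {fset K}, (B0 `<=` B)%fset -> [set` B] `<=` T ->
        exists s, [/\ uniq s, size s = m N,
          forall z, z \in s -> z ^+ m N = z &
          nX (\sum_(l <- B) c l *: pi l t - \sum_(l <- s) c l *: L N l t) < e].
  (* The maximum with 1 is needed because [T] is a union over levels N >= 1. *)
  move=> c1 e0; have [N0 xN0] := x_near t e0; pose N := maxn N0 1.
  have xN : nX (iter (m N) x t - x t) < e by apply: xN0; rewrite leq_maxl.
  have [s [s_uniq sz s_root]] := roots N.
  have sP z : (z \in s) = (z ^+ m N == z).
    apply/idP/eqP => [/s_root//|].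
    exact: (teich_roots_mem (m_gt1 N) s_uniq sz s_root).
  exists N, [fset z in s]%fset.
    by move=> z; rewrite /= inE => /s_root zN; exists N => //=; rewrite leq_maxr.
  move=> B sB BT; exists s; split => //.
  have -> : \sum_(l <- s) c l *: L N l t =
      \sum_(l <- B) c l *: (if l ^+ m N == l then L N l t else 0).
    rewrite -(big_fset_incl _ sB) => [|l _]; last first.
      by rewrite inE sP => /negPf ->; rewrite scaler0.
    rewrite [RHS](perm_big s) /=; last first.
      by apply: uniq_perm => [||z]; rewrite ?fset_uniq ?inE.
    by apply: eq_big_seq => l /s_root ->; rewrite eqxx.
  rewrite -sumrB; apply: (banach_sum_lt_seq nXP) => // l lB.
  have Tl := BT _ lB; rewrite -scalerBr (banachZ nXP).
  rewrite (le_lt_trans _ (pi_stable _ _ _ _ e0 xN Tl))//.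
  by rewrite ler_piMl ?(banach_ge0 nXP)// c1.
exists pi; split.
- by move=> l Tl; exists 1 => t; rewrite mul1r pi_le.
- move=> t e e0; have [l _|N [B0 B0T BE]] := pi_sum (fun=> 1) e t _ e0.
    by rewrite absval1.
  exists B0 => // B B0B BT; have [s [s_uniq sz s_root]] := BE _ B0B BT.
  under eq_bigr do rewrite scale1r; under [X in _ - X]eq_bigr do rewrite scale1r.
  rewrite -poly_op_sum (sum_teich_lagrange nKP (m_gt1 N) (nKm N) s_uniq sz)//.
  by rewrite poly_op1.
- move=> t e e0; have [l [N _ lN]|N [B0 B0T BE]] := pi_sum id e t _ e0.
    exact: absval_root lN.
  exists B0 => // B B0B BT; have [s [s_uniq sz s_root]] := BE _ B0B BT.
  under [X in _ - X]eq_bigr do rewrite -poly_opZ.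
  rewrite -poly_op_sum (sumZ_teich_lagrange nKP (m_gt1 N) (nKm N) s_uniq sz)//.
  by rewrite poly_opX.
- by move=> l Tl t; rewrite pi_pi// eqxx.
- by move=> l mu Tl Tmu /eqP lmu t; rewrite pi_pi// (negPf lmu).
Qed.

End Forward.
End OperatorCase.

Theorem theorem1p6 (R : realType) (p : nat) (p_prime : prime p)
    (Qp : fieldType) (nQ : Qp -> R) (q : {rmorphism rat -> Qp})
    (Qp_padic : is_padic_field p nQ q) :
  (forall (N : nat) (K : fieldType) (nK : K -> R) (i : {rmorphism Qp -> K})
      (A : comAlgType K) (nA : A -> R) (x : A),
    (1 <= N)%N ->
    unramified_ext nQ nK i ->
    (teichmuller_set p N K #= `I_(p ^ N))%card ->
    ultra_banach_algebra nK nA ->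
    range nA = range nK ->
    nA x <= 1 ->
    teichmuller_elt p N x <->
      exists pi : K -> A, spectral_decomposition p N nA x pi)
  /\
  (forall (C : closedFieldType) (nC : C -> R) (j : {rmorphism Qp -> C})
      (U : fieldType) (u : {rmorphism U -> C})
      (K : fieldType) (nK : K -> R) (k : {rmorphism U -> K})
      (X : lmodType K) (nX : X -> R) (x : {linear X -> X}),
    algebraic_valued_ext nQ nC j ->
    range u = max_unramified nQ nC j ->
    is_completion (fun a => nC (u a)) nK k ->
    ultra_banach nK nX ->
    range nX = range nK ->
    bounded_op nX x ->
    op_norm nX x = 1 ->
    teichmuller_op_infty nX p x <->
      exists pi : K -> {linear X -> X},
        spectral_decomposition_infty nX p x pi).
Proof.
have p1 := absval_p_lt1 p_prime Qp_padic.
split=> [N K nK i A nA x N1 [[nKP nKi _] _] cardT nAP _ x1|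
         C nC j U u K nK k X nX x Calg uE [nKP _ nKk _] nXP _ x_bounded x_norm].
  have nKp : nK p%:R < 1 by rewrite -(rmorph_nat i) nKi.
  have m_gt1 : (1 < p ^ N)%N by rewrite -(exp1n N) ltn_exp2r// prime_gt1.
  have nKm : nK (p ^ N)%:R < 1.
    by rewrite natrX absvalX// exprn_ilt1 ?(absval_ge0 nKP)// -lt0n.
  have Tfin : finite_set (teichmuller_set p N K) by apply/finite_setP; exists (p ^ N)%N.
  have s_root z : z \in enum_fset (fset_set (teichmuller_set p N K)) ->
      z ^+ (p ^ N) = z.
    by rewrite [_ \in _]in_fset_set// inE.
  have sz := card_fset_set cardT.
  have s_uniq := fset_uniq (fset_set (teichmuller_set p N K)).
  split=> [xm|[pi piP]].
    exact: (teichmuller_elt_decomposition nKP nAP m_gt1 nKm s_uniq sz s_root).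
  exact: (decomposition_teichmuller_elt m_gt1 s_uniq sz s_root piP).
have nKp : nK p%:R < 1.
  case: Calg => _ nCj _.
  by rewrite -(rmorph_nat k) nKk rmorph_nat -(rmorph_nat j) nCj.
(* Operator norm 1 means that [x] does not increase norms, on which the estimates in both directions
   rest. *)
have x_le1 t : nX (x t) <= nX t.
  by have := op_norm_ub nXP t x_bounded; rewrite x_norm mul1r.
split=> [[_ x_teich]|[pi piP]].
  apply: (teichmuller_op_decomposition nKP nXP p_prime nKp x_le1 _ x_teich) => N.
  exact: (enum_teichmuller p_prime k Qp_padic Calg uE (fact_gt0 N)).
by split=> //; exact: (decomposition_teichmuller_op nKP nXP x_le1 piP).
Qed.
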